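(* (i) Let $k,s\in\mathbb{R}$, let $Z\sim N(0,1)$, and let $P$ be the (infinitely divisible) law of $-k+|s|Z$. If the measure $Q$ defined by $dQ(x)=e^x\,dP(x)$ is a probability measure, then $s^2=2k$. (ii) More precisely, for a Gaussian law $P\in\mathcal I$ with Esscher tilt $dQ(x)=e^x\,dP(x)$: $Q$ is a probability measure and $T(P,Q)\in\mathcal I_T$ if and only if $P=N\left(-\frac{\mu^2}{2},\mu^2\right)$ for some $\mu\in\mathbb{R}$.
   Context: Gaussian laws on $\mathbb{R}$ may be degenerate (zero variance). For probability measures $P,Q$ on a measurable space $(\mathcal W,\mathcal F)$, the trade-off function $T(P,Q):[0,1]\to[0,1]$ is $$T(P,Q)(\alpha)=\inf\{\mathbb{E}_Q[1-\varphi] : \varphi:(\mathcal W,\mathcal F)\to[0,1]\text{ measurable},\ \mathbb{E}_P[\varphi]\le\alpha\}.$$ $\mathcal I$ is the set of all infinitely divisible probability measures on $(\mathbb{R},\mathcal B_{\mathbb R})$, and $$\mathcal I_T=\{T(P,Q): P\in\mathcal I \text{ and } dQ(x)=e^x\,dP(x)\},$$ where it is understood that $Q$ is a probability measure, i.e. $\int_{\mathbb R} e^x\,dP(x)=1$. *)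

(* Defs.v *)
From HB Require Import structures.
From mathcomp Require Import all_boot all_order all_algebra.
From mathcomp Require Import all_classical all_reals all_analysis.

Set Implicit Arguments.
Unset Strict Implicit.
Unset Printing Implicit Defensive.

Import Order.TTheory GRing.Theory Num.Theory.
Import numFieldNormedType.Exports.

Local Open Scope classical_set_scope.
Local Open Scope ring_scope.

(* A [probability T R] is a function on all subsets of [T], unconstrained on
   the non-measurable ones, so equality of laws is equality on measurable
   sets. *)
Definition same_law (R : realType) (P Q : set R -> \bar R) : Prop :=
  forall A : set R, measurable A -> P A = Q A.

(* N(m, v) with variance [v]. For a zero standard deviation [normal_prob] is
   uniform on [0, 1], hence the separate Dirac case; [v < 0] is junk. *)
Definition gaussian (R : realType) (m v : R) : set R -> \bar R :=
  if v == 0 then \d_m else normal_prob m (Num.sqrt v).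

Definition is_gaussian (R : realType) (P : set R -> \bar R) : Prop :=
  exists m v : R, 0 <= v /\ same_law P (gaussian m v).

Definition add2 (R : realType) (x : R * R) : R := x.1 + x.2.

Lemma measurable_add2 (R : realType) : measurable_fun setT (@add2 R).
Proof. by apply: measurable_realfun.measurable_funD. Qed.

HB.instance Definition _ (R : realType) :=
  isMeasurableFun.Build _ _ (R * R)%type R (@add2 R) (@measurable_add2 R).

Definition convolution (R : realType) (P Q : probability R R) :
  probability R R := distribution (P \x Q)%E (@add2 R).

Definition convolution_power (R : realType) (P : probability R R) (n : nat) :
  probability R R := iter n (convolution P) (\d_(0 : R)).

Definition infinitely_divisible (R : realType) : set (probability R R) :=
  [set P | forall n : nat, (0 < n)%N ->
     exists Pn : probability R R, same_law P (convolution_power Pn n)].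

Definition trade_off (d : measure_display) (W : measurableType d)
    (R : realType) (P Q : probability W R) (alpha : {i01 R}) : \bar R :=
  ereal_inf [set 'E_Q[(fun w => 1 - phi w)%R]%E | phi in
    [set phi : W -> R | [/\ measurable_fun setT phi,
       (forall w, 0 <= phi w <= 1) & ('E_P[phi] <= (alpha%:num%R)%:E)%E]]].

Lemma trade_off_itv (d : measure_display) (W : measurableType d)
    (R : realType) (P Q : probability W R) (alpha : {i01 R}) :
  (0 <= trade_off P Q alpha <= 1)%E.
Proof.
apply/andP; split.
  apply: le_ereal_inf_tmp => _ [phi [_ phi01 _] <-].
  rewrite unlock; apply: integral_ge0 => w _.
  by rewrite lee_fin subr_ge0; case/andP: (phi01 w).
apply: ereal_inf_lbound; exists (cst 0).
  split=> [//|w|]; first by rewrite lexx ler01.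
  by rewrite expectation_cst lee_fin.
by rewrite -[RHS](expectation_cst Q); congr expectation; apply/funext => w;
  rewrite /= subr0.
Qed.

(* dQ(x) = e^x dP(x); as [Q] is a probability, this entails
   \int e^x dP(x) = 1. *)
Definition esscher_tilt (R : realType) (P Q : probability R R) : Prop :=
  same_law Q (fun A => \int[P]_(x in A) (expR x)%:E)%E.

Definition I_T (R : realType) : set ({i01 R} -> \bar R) :=
  [set f | exists P Q : probability R R,
     [/\ infinitely_divisible P, esscher_tilt P Q & f = trade_off P Q]].

(* Main.v *)
(** By completing the square, a Gaussian law satisfies
    [e^x N(m, v)(dx) = e^(m + v/2) N(m + v, v)(dx)], so its tilt has mass 1
    exactly when [m = - v/2].
    Gaussian laws are infinitely divisible because [N(m1, v1) * N(m2, v2) =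
    N(m1 + m2, v1 + v2)]: by Fubini the density of the convolution at [z] is the
    integral in [x] of [p1 x * p2 (z - x)], and this product factors as the
    density of the sum at [z] times a Gaussian density in [x]. *)

Require Import Defs.
From HB Require Import structures.
From mathcomp Require Import all_boot all_order all_algebra.
From mathcomp Require Import all_classical all_reals all_analysis.
From mathcomp Require Import measurable_realfun.
From mathcomp Require Import ring lra.

Set Implicit Arguments.
Unset Strict Implicit.
Unset Printing Implicit Defensive.

Import Order.TTheory GRing.Theory Num.Theory.
Import numFieldNormedType.Exports.

Local Open Scope classical_set_scope.
Local Open Scope ring_scope.

(** * Integration against normal densities and affine change of variables *)

Lemma ge0_integral_normal_prob (R : realType) (m s : R) (D : set R)
    (f : R -> \bar R) : measurable D -> measurable_fun D f ->
    (forall x, 0 <= f x)%E ->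
  (\int[normal_prob m s]_(x in D) f x =
   \int[lebesgue_measure]_(x in D) (f x * (normal_pdf m s x)%:E))%E.
Proof.
move=> mD mf f0; have dom := normal_prob_dominates m s.
rewrite -(Radon_Nikodym_SigmaFinite.change_of_variables dom)//.
have intRN := Radon_Nikodym_SigmaFinite.f_integrable dom.
have mpdf : measurable_fun D (EFin \o normal_pdf m s).
  by apply/measurable_funTS/measurableT_comp => //; exact: measurable_normal_pdf.
apply: ae_eq_integral => //.
- apply: emeasurable_funM => //; apply: measurable_funTS.
  exact: measurable_int intRN.
- exact: emeasurable_funM.
(* The Radon-Nikodym derivative and the explicit density agree almost everywhere because they have
   the same integral over every measurable subset of [D]. *)
- apply: ae_eqe_mul2l; apply: integral_ae_eq => //.
    exact: integrableS intRN.
  by move=> E ED mE; rewrite -Radon_Nikodym_SigmaFinite.f_integral.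
Qed.

Lemma measurable_affine (R : realType) (a b : R) :
  measurable_fun setT (fun x : R => b + a * x).
Proof. by apply: measurable_funD => //; exact: measurable_funM. Qed.

(** By uniqueness of Lebesgue measure: the image of [lebesgue_measure] under [x -> b + a x], scaled
    by [a], gives each half-open interval its length. *)
Lemma lebesgue_measure_affine (R : realType) (a b : R) (A : set R) :
    0 < a -> measurable A ->
  (lebesgue_measure A =
   a%:E * lebesgue_measure ((fun x : R => b + a * x)%R @^-1` A))%E.
Proof.
move=> a0 mA.
pose aff : measurableTypeR R -> measurableTypeR R := fun x => b + a * x.
have maff : measurable_fun setT aff by exact: measurable_affine.
pose mu := mscale (NngNum (ltW a0)) (pushforward (@lebesgue_measure R) aff)
  : {measure set (measurableTypeR R) -> \bar R}.
apply: (@lebesgue_measure_unique R (mu maff)) => // _ [[x y] /= xy] <-.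
rewrite /mscale/= /pushforward.
rewrite (_ : aff @^-1` _ = `](x - b) / a, (y - b) / a]%classic); last first.
  apply/seteqP; split => z /=; rewrite /aff !in_itv/=
    ltr_pdivrMr// ler_pdivlMr// ltrBlDr lerBrDr (mulrC z) (addrC b)//.
rewrite !lebesgue_measure_itv/= !lte_fin ltr_pM2r ?invr_gt0// ltrD2r.
case: ifPn => _; last by rewrite mule0.
rewrite -!EFinD -EFinM; congr (_%:E); field; exact: lt0r_neq0.
Qed.

Lemma ge0_integral_affine (R : realType) (a b : R) (f : R -> \bar R) :
    0 < a -> measurable_fun setT f -> (forall x, 0 <= f x)%E ->
  (\int[lebesgue_measure]_x f x =
   a%:E * \int[lebesgue_measure]_x f (b + a * x)%R)%E.
Proof.
move=> a0 mf f0.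
pose aff : measurableTypeR R -> measurableTypeR R := fun x => b + a * x.
have maff : measurable_fun setT aff by exact: measurable_affine.
pose mu := mscale (NngNum (ltW a0)) (pushforward (@lebesgue_measure R) aff)
  : {measure set (measurableTypeR R) -> \bar R}.
transitivity (\int[mu maff]_x f x)%E.
  by apply: eq_measure_integral => A mA _; exact: lebesgue_measure_affine.
by rewrite ge0_integral_mscale// ge0_integral_pushforward.
Qed.

(** * Identities between normal densities *)

Lemma normal_peak_gt0E (R : realType) (s : R) :
  0 < s -> normal_peak s = (s * Num.sqrt (pi *+ 2))^-1.
Proof.
move=> s0; rewrite /normal_peak -mulrnAr sqrtrM ?sqr_ge0//.
by rewrite sqrtr_sqr gtr0_norm.
Qed.

Lemma normal_pdf_affine (R : realType) (a b m s x : R) : 0 < a -> 0 < s ->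
  a * normal_pdf (b + a * m) (a * s) (b + a * x) = normal_pdf m s x.
Proof.
move=> a0 s0; have [an0 sn0] := (lt0r_neq0 a0, lt0r_neq0 s0).
rewrite !normal_pdfE ?mulf_neq0// !normal_peak_gt0E ?mulr_gt0// mulrA.
congr (_ * expR _); last by field; rewrite an0 sn0.
by rewrite -mulrA invfM mulrA divff// mul1r.
Qed.

(** Completing the square: [x - (x - m)^2 / (2 s^2) = m + s^2 / 2 - (x - m - s^2)^2 / (2 s^2)]. *)
Lemma expR_normal_pdf (R : realType) (m s x : R) : 0 < s ->
  expR x * normal_pdf m s x =
  expR (m + s ^+ 2 / 2) * normal_pdf (m + s ^+ 2) s x.
Proof.
move=> s0; have sn0 := lt0r_neq0 s0.
rewrite !normal_pdfE// ![expR _ * (_ * _)]mulrCA -!expRD.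
by congr (_ * expR _); field.
Qed.

(* The conditional law of the first summand given the sum [z] is Gaussian, with
   mean [m1 + s1^2 / s^2 (z - m1 - m2)] and standard deviation [s1 s2 / s]. *)
Lemma normal_pdf_mul (R : realType) (m1 m2 s1 s2 s x z : R) :
    0 < s1 -> 0 < s2 -> 0 < s -> s ^+ 2 = s1 ^+ 2 + s2 ^+ 2 ->
  normal_pdf m1 s1 x * normal_pdf m2 s2 (z - x) =
  normal_pdf (m1 + m2) s z *
  normal_pdf (m1 + s1 ^+ 2 / s ^+ 2 * (z - m1 - m2)) (s1 * s2 / s) x.
Proof.
move=> s1_gt0 s2_gt0 s_gt0 sE.
have [s1n0 s2n0 sn0] :=
  And3 (lt0r_neq0 s1_gt0) (lt0r_neq0 s2_gt0) (lt0r_neq0 s_gt0).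
rewrite !normal_pdfE ?mulf_neq0 ?invr_eq0//.
rewrite !normal_peak_gt0E ?divr_gt0 ?mulr_gt0//.
rewrite [LHS]mulrACA [RHS]mulrACA -!expRD; congr (_ * expR _).
  (* The peaks agree since [s1 s2 = s (s1 s2 / s)]. *)
  by rewrite -!invfM; congr (_^-1); field.
have v0 : s1 ^+ 2 + s2 ^+ 2 != 0 by rewrite -sE expf_neq0.
rewrite !expr_div_n !sE.
by field; rewrite v0 s2n0 s1n0.
Qed.

(** * Affine images of Gaussian laws, and Gaussian laws as probabilities *)

Lemma normal_prob_affine (R : realType) (a b m s : R) (A : set R) :
    0 < a -> 0 < s -> measurable A ->
  normal_prob (b + a * m) (a * s) A =
  normal_prob m s ((fun x : R => b + a * x) @^-1` A).
Proof.
move=> a0 s0 mA; rewrite /normal_prob integral_mkcond [RHS]integral_mkcond.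
have mpdf c r (D : set R) : measurable D ->
    measurable_fun setT ((fun x => (normal_pdf c r x)%:E) \_ D).
  move=> mD; apply/(measurable_restrictT _ mD).
  by apply/measurable_funTS/measurableT_comp => //; exact: measurable_normal_pdf.
have pdf0 c r (D : set R) x : (0 <= ((fun x => (normal_pdf c r x)%:E) \_ D) x)%E.
  by apply: erestrict_ge0 => ? _; rewrite lee_fin normal_pdf_ge0.
rewrite (ge0_integral_affine b a0)//; last exact: mpdf.
rewrite -ge0_integralZl ?lee_fin ?ltW//; last first.
  by apply: measurableT_comp (measurable_affine a b); exact: mpdf.
apply: eq_integral => x _; rewrite !patchE.
have -> : (x \in (fun x : R => b + a * x) @^-1` A) = (b + a * x \in A).
  by apply/idP/idP; rewrite !inE.
case: ifP => _; last by rewrite mule0.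
by rewrite -EFinM normal_pdf_affine.
Qed.

(** The law becomes a Dirac mass when [v = 0] or [a = 0]; otherwise densities transform. Allowing
    [a = 0] covers a degenerate [-k + |s| Z]. *)
Lemma gaussian_affine (R : realType) (a b m v : R) (A : set R) :
    0 <= a -> 0 <= v -> measurable A ->
  gaussian (b + a * m) (a ^+ 2 * v) A =
  gaussian m v ((fun x : R => b + a * x) @^-1` A).
Proof.
move=> a0 v0 mA; rewrite /gaussian mulf_eq0 sqrf_eq0.
have [->|vn0] := eqVneq v 0.
  by rewrite orbT /dirac !indicE; congr (_%:R%:E); apply/idP/idP; rewrite !inE.
rewrite orbF; have [->|an0] := eqVneq a 0.
  rewrite mul0r addr0 /dirac indicE.
  have -> : (fun x : R => b + 0 * x) = cst b.
    by apply/funext => x /=; rewrite mul0r addr0.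
  rewrite preimage_cst; case: ifP => _; last by rewrite measure0.
  exact/esym/probability_setT.
have sv : 0 < Num.sqrt v by rewrite sqrtr_gt0 lt0r vn0.
rewrite sqrtrM ?sqr_ge0// sqrtr_sqr ger0_norm//.
by apply: normal_prob_affine => //; rewrite lt0r an0.
Qed.

(* [normal_prob] and [lebesgue_measure] live on [measurableTypeR R], whose
   display differs from the one of the [measurableType] [R]; pushing forward
   along the identity moves a measure from the one to the other. *)
Lemma measurable_id_measurableTypeR (R : realType) :
  measurable_fun setT (idfun : measurableTypeR R -> R).
Proof. by move=> _ A mA; rewrite setTI. Qed.

(** [gaussian m v] is a bare set function; this supplies the bundled probabilities needed as
    witnesses for convolution roots and tilts. *)
Lemma gaussian_is_probability (R : realType) (m v : R) :
  exists G : probability R R, gaussian m v = G.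
Proof.
rewrite /gaussian; case: ifP => _; first by exists \d_m.
pose X : {mfun measurableTypeR R >-> R} :=
  HB.pack (idfun : measurableTypeR R -> R)
    (isMeasurableFun.Build _ _ _ _ _ (@measurable_id_measurableTypeR R)).
by exists (distribution (normal_prob m (Num.sqrt v)) X).
Qed.

(** * Exponential tilting of Gaussian laws *)

Lemma ge0_integral_normal_law (R : realType) (m s : R) (P : probability R R)
    (D : set R) (f : R -> \bar R) :
    same_law P (normal_prob m s) -> measurable D -> measurable_fun D f ->
    (forall x, 0 <= f x)%E ->
  (\int[P]_(x in D) f x =
   \int[lebesgue_measure]_(x in D) (f x * (normal_pdf m s x)%:E))%E.
Proof.
move=> Pms mD mf f0; rewrite -ge0_integral_normal_prob//.
pose mid := @measurable_id_measurableTypeR R.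
pose P' := pushforward (normal_prob m s) (idfun : measurableTypeR R -> R)
  : {measure set R -> \bar R}.
rewrite (eq_measure_integral (P' mid)); last by move=> A mA _; exact: Pms.
by rewrite ge0_integral_pushforward.
Qed.

Lemma gaussian_esscher (R : realType) (m v : R) (P : probability R R)
    (A : set R) :
    0 <= v -> same_law P (gaussian m v) -> measurable A ->
  (\int[P]_(x in A) (expR x)%:E =
   (expR (m + v / 2))%:E * gaussian (m + v) v A)%E.
Proof.
move=> v0 Pg mA.
have mexp (D : set R) : measurable_fun D (fun x : R => (expR x)%:E).
  by apply/measurable_funTS/measurable_EFinP.
move: Pg; rewrite /gaussian; have [->|vn0] := eqVneq v 0 => Pg.
  (* For [v = 0] the tilt of the Dirac mass at [m] is that mass times [e^m]. *)
  rewrite (eq_measure_integral \d_m); last by move=> B mB _; exact: Pg.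
  by rewrite integral_dirac// mul0r !addr0 muleC.
have sv : 0 < Num.sqrt v by rewrite sqrtr_gt0 lt0r vn0.
rewrite (ge0_integral_normal_law Pg mA)// /normal_prob.
rewrite -ge0_integralZl//; last 2 first.
- by apply/measurable_funTS/measurableT_comp => //; exact: measurable_normal_pdf.
- by move=> x _; rewrite lee_fin normal_pdf_ge0.
apply: eq_integral => x _.
by rewrite -!EFinM expR_normal_pdf// sqr_sqrtr.
Qed.

(** * Convolution of Gaussian laws *)

Lemma integral_normal_law_translate (R : realType) (m1 m2 s1 s2 s : R)
    (P : probability R R) (A : set R) :
    0 < s1 -> 0 < s2 -> 0 < s -> s ^+ 2 = s1 ^+ 2 + s2 ^+ 2 ->
    same_law P (normal_prob m1 s1) -> measurable A ->
  (\int[P]_x normal_prob m2 s2 ((fun y => x + y)%R @^-1` A) =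
   normal_prob (m1 + m2) s A)%E.
Proof.
move=> s1_gt0 s2_gt0 s_gt0 sE Pms mA.
(* In [z], [g (x, z)] is the density of [N(m2, s2^2)] translated by [x], cut off outside [A]. *)
pose g (p : measurableTypeR R * measurableTypeR R) : \bar R :=
  (\1_A p.2 * normal_pdf m2 s2 (p.2 - p.1))%:E.
have g0 p : (0 <= g p)%E by rewrite lee_fin mulr_ge0 ?normal_pdf_ge0.
have mg : measurable_fun setT g.
  apply/measurable_EFinP/measurable_funM.
    by apply: measurableT_comp => //; exact: measurable_indic.
  apply: measurableT_comp (measurable_normal_pdf m2 s2) _.
  exact: measurable_funB.
pose f p := ((normal_pdf m1 s1 p.1)%:E * g p)%E.
have f0 p : (0 <= f p)%E by rewrite mule_ge0// lee_fin normal_pdf_ge0.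
have mf : measurable_fun setT f.
  apply: emeasurable_funM => //; apply/measurable_EFinP.
  by apply: measurableT_comp (measurable_normal_pdf m1 s1) _.
transitivity (\int[lebesgue_measure]_x \int[lebesgue_measure]_z f (x, z))%E.
  have translate x : normal_prob m2 s2 ((fun y => x + y) @^-1` A) =
      (\int[lebesgue_measure]_z g (x, z))%E.
    have := @normal_prob_affine R 1 x m2 s2 A ltr01 s2_gt0 mA.
    rewrite !mul1r (_ : (fun y => x + 1 * y) = (fun y => x + y)); last first.
      by apply/funext => y; rewrite mul1r.
    move=> <-; rewrite /normal_prob integral_mkcond; apply: eq_integral => z _.
    rewrite patchE /g/= indicE; case: ifP => _; last by rewrite mul0r.
    have := @normal_pdf_affine R 1 x m2 s2 (z - x) ltr01 s2_gt0.
    by rewrite !mul1r subrKC => ->.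
  under eq_integral do rewrite translate.
  rewrite (ge0_integral_normal_law Pms)//; last first.
  - by move=> x; apply: integral_ge0.
  - exact: (measurable_fun_fubini_tonelli_F g).
  apply: eq_integral => x _; rewrite muleC -ge0_integralZl//.
  - by apply: measurableT_comp mg _.
  - by rewrite lee_fin normal_pdf_ge0.
(* Exchanging the integrals leaves, for fixed [z], an integral in [x] to be compared with the
   density of the sum at [z]. *)
rewrite fubini_tonelli//.
rewrite /normal_prob [RHS]integral_mkcond; apply: eq_integral => z _.
rewrite patchE; case: ifP => zA; last first.
  by apply: integral0_eq => x _; rewrite /f /g indicE zA mul0r mule0.
(* By [normal_pdf_mul] the density of the sum comes out of the integral; the other factor is a
   normal density in [x], of integral 1. *)
transitivity (\int[lebesgue_measure]_x ((normal_pdf (m1 + m2) s z)%:E *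
  (normal_pdf (m1 + s1 ^+ 2 / s ^+ 2 * (z - m1 - m2)) (s1 * s2 / s) x)%:E))%E.
  apply: eq_integral => x _; rewrite /f /g indicE zA mul1r -!EFinM.
  by rewrite (@normal_pdf_mul _ _ _ _ _ s).
rewrite ge0_integralZl ?lee_fin ?normal_pdf_ge0//.
- by rewrite integral_normal_pdf mule1.
- by apply: measurableT_comp => //; exact: measurable_normal_pdf.
- by move=> x _; rewrite lee_fin normal_pdf_ge0.
Qed.

Lemma xsection_add2 (R : realType) (A : set R) (x : R) :
  xsection (@add2 R @^-1` A) x = (fun y => x + y) @^-1` A.
Proof. by apply/seteqP; split => y /=; rewrite /xsection/= inE. Qed.

Lemma convolutionE (R : realType) (P Q : probability R R) (A : set R) :
  (convolution P Q A = \int[P]_x Q ((fun y => x + y)%R @^-1` A))%E.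
Proof. by apply: eq_integral => x _ /=; rewrite xsection_add2. Qed.

(** The translated sets are the sections of the preimage of [A] under addition, so this is
    measurability of the measure of sections. *)
Lemma measurable_fun_translate (R : realType) (Q : probability R R)
    (A : set R) :
  measurable A ->
  measurable_fun setT (fun x : R => Q ((fun y => x + y) @^-1` A)).
Proof.
move=> mA; under eq_fun do rewrite -xsection_add2.
apply: (measurable_fun_xsection Q).
by rewrite -[X in measurable X]setTI; exact: measurable_add2.
Qed.

(** Convolving with a Dirac mass is a translation, which settles a zero variance on either side; two
    positive variances reduce to the computation with densities. *)
Lemma same_law_convolution_gaussian (R : realType) (m1 m2 v1 v2 : R)
    (P Q : probability R R) :
    0 <= v1 -> 0 <= v2 ->
    same_law P (gaussian m1 v1) -> same_law Q (gaussian m2 v2) ->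
  same_law (convolution P Q) (gaussian (m1 + m2) (v1 + v2)).
Proof.
move=> v1_ge0 v2_ge0 Pg Qg A mA; rewrite convolutionE.
have translate m v x : 0 <= v ->
    gaussian (x + m) v A = gaussian m v ((fun y => x + y) @^-1` A).
  move=> v0; have := gaussian_affine x m ler01 v0 mA.
  rewrite expr1n !mul1r => ->; congr (gaussian m v (_ @^-1` A)).
  by apply/funext => y; rewrite mul1r.
have mpre x : measurable ((fun y : R => x + y) @^-1` A).
  by rewrite -[X in measurable X]setTI; exact: measurable_funD.
have [v10|v1n0] := eqVneq v1 0.
  have P0 : same_law P \d_m1 by move: Pg; rewrite /gaussian v10 eqxx.
  rewrite (eq_measure_integral \d_m1); last by move=> B mB _; exact: P0.
  rewrite integral_dirac//; last exact: measurable_fun_translate.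
  by rewrite diracT mul1e Qg// v10 add0r (translate m2 v2 m1 v2_ge0).
under eq_integral do rewrite Qg//.
have [v20|v2n0] := eqVneq v2 0.
  rewrite (eq_integral (fun x => (\1_((fun y => m2 + y) @^-1` A) x)%:E)).
    rewrite integral_indic// setIT v20 addr0 addrC.
    by rewrite (translate m1 v1 m2 v1_ge0) -Pg.
  move=> x _; rewrite v20 /gaussian eqxx /dirac !indicE.
  by congr ((_ : bool)%:R%:E); apply/idP/idP; rewrite !inE/= addrC.
move: Pg; rewrite /gaussian (negbTE v1n0) (negbTE v2n0) => Pg.
have v1_gt0 : 0 < v1 by rewrite lt0r v1n0.
have v2_gt0 : 0 < v2 by rewrite lt0r v2n0.
rewrite gt_eqF ?addr_gt0//.
by apply: integral_normal_law_translate Pg _ => //;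
  rewrite ?sqrtr_gt0 ?addr_gt0// !sqr_sqrtr// addr_ge0.
Qed.

(** * Infinite divisibility, normalisation of the tilt, and the theorem *)

Lemma infinitely_divisible_gaussian (R : realType) (m v : R)
    (P : probability R R) :
  0 <= v -> same_law P (gaussian m v) -> infinitely_divisible P.
Proof.
move=> v0 Pg n n0.
have [G GE] := gaussian_is_probability (m / n%:R) (v / n%:R).
have Gg : same_law G (gaussian (m / n%:R) (v / n%:R)) by rewrite GE.
exists G => A mA; rewrite Pg//.
(* The root [N(m/n, v/n)] stays fixed while the exponent [k] varies, so that induction applies; then
   [k = n]. *)
suff powG k : same_law (convolution_power G k)
    (gaussian (m / n%:R *+ k) (v / n%:R *+ k)).
  have nn0 : n%:R != 0 :> R by rewrite pnatr_eq0 -lt0n.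
  rewrite (powG n A mA) -(mulr_natr (m / n%:R)) -(mulr_natr (v / n%:R)).
  by rewrite !divfK.
(* The empty convolution is the Dirac mass at 0, which is [gaussian 0 0]. *)
elim: k => [|k IHk] B mB; first by rewrite !mulr0n /gaussian eqxx.
rewrite !mulrS; apply: same_law_convolution_gaussian => //.
- by rewrite divr_ge0.
- by rewrite mulrn_wge0// divr_ge0.
Qed.

(** Evaluating the tilt on the whole line gives [e^(m + v/2) = 1]. *)
Lemma gaussian_esscher_tilt (R : realType) (m v : R) (P Q : probability R R) :
    0 <= v -> same_law P (gaussian m v) -> esscher_tilt P Q ->
  m = - (v / 2).
Proof.
move=> v0 Pg PQ; have := PQ setT measurableT.
have [G GE] := gaussian_is_probability (m + v) v.
rewrite (gaussian_esscher v0 Pg measurableT) GE !probability_setT mule1.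
by case; rewrite -[LHS]expR0 => /expR_inj; lra.
Qed.

Theorem theorem3 (R : realType) :
  (forall (k s : R) (d : measure_display) (Omega : measurableType d)
     (Pr : probability Omega R) (Z : {RV Pr >-> R}) (P : probability R R),
     same_law (distribution Pr Z) (gaussian 0 1) ->
     same_law P (pushforward Pr (fun w => - k + `|s| * Z w)) ->
     infinitely_divisible P /\
     (forall Q : probability R R, esscher_tilt P Q -> s ^+ 2 = 2 * k))
  /\
  (forall P : probability R R,
     is_gaussian P -> infinitely_divisible P ->
     ((exists Q : probability R R,
         esscher_tilt P Q /\ I_T (trade_off P Q)) <->
      (exists mu : R, same_law P (gaussian (- (mu ^+ 2 / 2)) (mu ^+ 2))))).
Proof.
split=> [k s d Omega Pr Z P Zg Ppush|P [m [v [v0 Pg]]] Pid].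
  have Pg : same_law P (gaussian (- k) (s ^+ 2)).
    move=> A mA.
    have := gaussian_affine (- k) 0 (normr_ge0 s) ler01 mA.
    rewrite real_normK ?num_real// mulr0 addr0 mulr1 => ->.
    rewrite -Zg ?Ppush//.
    by rewrite -[X in measurable X]setTI; exact: measurable_affine.
  split; first exact: infinitely_divisible_gaussian (sqr_ge0 s) Pg.
  move=> Q /(gaussian_esscher_tilt (sqr_ge0 s) Pg)/oppr_inj ->.
  by rewrite mulrC divfK.
split=> [[Q [PQ _]]|[mu Pmu]].
  exists (Num.sqrt v).
  by rewrite sqr_sqrtr// -(gaussian_esscher_tilt v0 Pg PQ).
(* With [m = - mu^2 / 2] and [v = mu^2], the tilt is [N(m + v, v)] with prefactor
   [e^(m + v/2) = 1]. *)
have [Q QE] := gaussian_is_probability (- (mu ^+ 2 / 2) + mu ^+ 2) (mu ^+ 2).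
have PQ : esscher_tilt P Q.
  move=> A mA; rewrite (gaussian_esscher (sqr_ge0 mu) Pmu mA).
  by rewrite addNr expR0 mul1e QE.
by exists Q; split=> //; exists P, Q.
Qed.
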